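(* Assume that $\lambda_{m-1}<\lambda_m$ if $m>1$, and $\lambda_M<\lambda_{M+1}$. Then $$\|A^{1/2}(\gamma^0-\gamma_h)\|_{\mathfrak S_2(\mathcal H)}^2-\lambda_M\|\gamma^0-\gamma_h\|_{\mathfrak S_2(\mathcal H)}^2\le\sum_{i=m}^M(\lambda_{ih}-\lambda_i)\le\|A^{1/2}(\gamma^0-\gamma_h)\|_{\mathfrak S_2(\mathcal H)}^2.$$
   Context: $\mathcal H$ is a real separable Hilbert space with inner product $(\cdot,\cdot)$ and norm $\|\cdot\|$; $\|B\|_{\mathfrak S_2(\mathcal H)}$ is the Hilbert–Schmidt norm. $A$ is a self-adjoint, positive definite operator on $\mathcal H$ with domain $D(A)$ and compact resolvent; $(\lambda_k)_{k\ge1}$ is the nondecreasing sequence of its (positive) eigenvalues counted with multiplicity, $\lambda_k\to+\infty$, and $(\varphi_k^0)_{k\ge1}$ is an orthonormal basis of $\mathcal H$ with $A\varphi_k^0=\lambda_k\varphi_k^0$. For $s\in\mathbb{R}$, $D(A^s):=\{v\in\mathcal H:\sum_k\lambda_k^{2s}|(v,\varphi_k^0)|^2<\infty\}$ and $A^sv:=\sum_k\lambda_k^s(v,\varphi_k^0)\varphi_k^0$. Let $1\le m\le M$ be integers. $V_h\subset D(A^{1/2})$ is a finite-dimensional subspace with $\dim V_h\ge M$. The approximate eigenpairs $(\varphi_{kh},\lambda_{kh})\in V_h\times\mathbb{R}_+$, $1\le k\le\dim V_h$, satisfy $(\varphi_{kh},\varphi_{jh})=\delta_{kj}$, $(A^{1/2}\varphi_{kh},A^{1/2}v_h)=\lambda_{kh}(\varphi_{kh},v_h)$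 for all $v_h\in V_h$, and $0<\lambda_{1h}\le\lambda_{2h}\le\cdots$ (counting multiplicities). The density matrices are $\gamma^0v:=\sum_{i=m}^M(v,\varphi_i^0)\varphi_i^0$ and $\gamma_hv:=\sum_{i=m}^M(v,\varphi_{ih})\varphi_{ih}$ for $v\in\mathcal H$. *)

(* Defs.v *)
From HB Require Import structures.
From mathcomp Require Import all_boot all_order all_algebra.
From mathcomp Require Import all_classical all_reals all_analysis.
Import Order.TTheory GRing.Theory Num.Theory.
Import numFieldNormedType.Exports.

Set Implicit Arguments.
Unset Strict Implicit.
Unset Printing Implicit Defensive.

Local Open Scope classical_set_scope.
Local Open Scope ring_scope.

(* A real Hilbert space is a complete normed module [H] over [R : realType]
   together with an inner product [dot : {dot H for idfun}] inducing its norm.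
   Families written with a 1-based index in the mathematics (the exact and the
   discrete eigenpairs) are functions on [nat] whose value at 0 is never used. *)

Definition induces_norm (R : realType) (H : completeNormedModType R)
    (dot : {dot H for idfun}) : Prop :=
  forall x : H, `|x| ^+ 2 = dot x x.

Definition separable_space (T : topologicalType) : Prop :=
  exists2 D : set T, countable D & dense D.

Section Operators.
Variables (R : realType) (H : completeNormedModType R).
Variable dot : {dot H for idfun}.

Definition linear_subspace (V : set H) : Prop :=
  V 0 /\ forall (a : R) (u v : H), V u -> V v -> V (a *: u + v).

(* An unbounded operator is a pair of a domain [D] and a total function [A];
   only the values of [A] on [D] are meaningful. *)
Definition linear_operator (D : set H) (A : H -> H) : Prop :=
  linear_subspace D /\
  forall (a : R) (u v : H), D u -> D v -> A (a *: u + v) = a *: A u + A v.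

(* The left-hand side of the equivalence says that (w, z) belongs to the graph
   of the adjoint of A, the right-hand side that it belongs to the graph of A. *)
Definition self_adjoint (D : set H) (A : H -> H) : Prop :=
  [/\ linear_operator D A, dense D &
      forall w z : H,
        (forall v, D v -> dot (A v) w = dot v z) <-> (D w /\ A w = z)].

Definition positive_definite (D : set H) (A : H -> H) : Prop :=
  forall v, D v -> v != 0 -> 0 < dot (A v) v.

Definition compact_operator (T : H -> H) : Prop :=
  linear T /\ precompact (T @` [set x : H | `|x| <= 1]).

(* [T] is the resolvent (A - z)^-1, defined on the whole space. *)
Definition compact_resolvent (D : set H) (A : H -> H) : Prop :=
  exists (z : R) (T : H -> H),
    [/\ forall u, D (T u) /\ A (T u) - z *: T u = u,
        forall v, D v -> T (A v - z *: v) = v &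
        compact_operator T].

Definition orthonormal_basis (e : nat -> H) : Prop :=
  (forall i j, dot (e i) (e j) = (i == j)%:R) /\
  (forall v, series (fun k => dot v (e k) *: e k) @ \oo --> v).

(* D(A^s) and A^s, from the eigenpairs (lam k, phi k), k >= 1, of A. *)
Definition dom_power (lam : nat -> R) (phi : nat -> H) (s : R) : set H :=
  [set v | (\sum_(1 <= k <oo)
      (lam k `^ (2 * s) * `|dot v (phi k)| ^+ 2)%:E < +oo)%E].

Definition power (lam : nat -> R) (phi : nat -> H) (s : R) (v : H) : H :=
  limn (fun n => \sum_(1 <= k < n) (lam k `^ s * dot v (phi k)) *: phi k).

(* Hilbert-Schmidt norm computed in the orthonormal basis [e]; its value,
   possibly +oo, does not depend on that basis when [B] is linear and bounded. *)
Definition hs_norm (e : nat -> H) (B : H -> H) : \bar R :=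
  sqrte (\sum_(0 <= k <oo) (`|B (e k)| ^+ 2)%:E)%E.

Definition density_matrix (m M : nat) (phi : nat -> H) (v : H) : H :=
  \sum_(m <= i < M.+1) dot v (phi i) *: phi i.

Definition has_dim (V : set H) (N : nat) : Prop :=
  exists b : 'I_N -> H,
    (forall c : 'I_N -> R, \sum_i c i *: b i = 0 -> forall i, c i = 0) /\
    V = [set v | exists c : 'I_N -> R, v = \sum_i c i *: b i].

(* A^(1/2) in the Galerkin equation is the operator given by the exact
   eigenpairs (lam, phi); (lamh k, phih k), 1 <= k <= N, are the discrete ones. *)
Definition galerkin_eigenpairs (lam : nat -> R) (phi : nat -> H)
    (V : set H) (N : nat) (lamh : nat -> R) (phih : nat -> H) : Prop :=
  [/\ forall k, (1 <= k <= N)%N -> V (phih k),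
      forall k j, (1 <= k <= N)%N -> (1 <= j <= N)%N ->
        dot (phih k) (phih j) = (k == j)%:R,
      forall k v, (1 <= k <= N)%N -> V v ->
        dot (power lam phi 2^-1 (phih k)) (power lam phi 2^-1 v)
        = lamh k * dot (phih k) v,
      forall k, (1 <= k <= N)%N -> 0 < lamh k &
      forall j k, (1 <= j)%N -> (j <= k)%N -> (k <= N)%N -> lamh j <= lamh k].

End Operators.

(* Main.v *)
(* Put [c i = \sum_j (phi i, phih j)^2], which is at most 1 by Bessel's
   inequality.  Since both families are orthonormal, Parseval's identity in the
   basis [e] gives
     [|err|^2 = \sum_i (2 - 2 c i)] and
     [|A^(1/2) err|^2 = \sum_i (lam i + lamh i - 2 lam i * c i)],
   the cross terms of the latter being computed with
   [(A^(1/2) phih j, phi i) = lam i^(1/2) (phih j, phi i)].  Hence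
   [|A^(1/2) err|^2 - \sum_i (lamh i - lam i) = 2 \sum_i lam i * (1 - c i)],
   which is nonnegative and at most [lam M * |err|^2]. *)

Require Import Defs.
From HB Require Import structures.
From mathcomp Require Import all_boot all_order all_algebra.
From mathcomp Require Import all_classical all_reals all_analysis.
From mathcomp Require Import ring lra.
Import Order.TTheory GRing.Theory Num.Theory.
Import numFieldNormedType.Exports.

Set Implicit Arguments.
Unset Strict Implicit.
Unset Printing Implicit Defensive.

Local Open Scope classical_set_scope.
Local Open Scope ring_scope.

(** * Inner product: continuity, Parseval, Bessel, orthogonal series *)

Section InnerProduct.
Variables (R : realType) (H : completeNormedModType R).
Variable dot : {dot H for idfun}.
Hypothesis dot_norm : induces_norm dot.

Lemma dotC u v : dot u v = dot v u.
Proof. by rewrite (hermC dot) expr0 mul1r. Qed.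

Lemma dotZl a u v : dot (a *: u) v = a * dot u v.
Proof. exact: linearZl_LR. Qed.

Lemma dotZr a u v : dot u (a *: v) = a * dot u v.
Proof. by rewrite dotC dotZl dotC. Qed.

Lemma dot_suml I (r : seq I) (F : I -> H) v :
  dot (\sum_(i <- r) F i) v = \sum_(i <- r) dot (F i) v.
Proof. exact: linear_sumlz. Qed.

Lemma dot_sumr I (r : seq I) (F : I -> H) v :
  dot v (\sum_(i <- r) F i) = \sum_(i <- r) dot v (F i).
Proof. exact: linear_sumr. Qed.

Lemma sqr_normB u v : `|u - v| ^+ 2 = dot u u - 2 * dot u v + dot v v.
Proof.
by rewrite dot_norm linearBl !linearBr/= (dotC v u); ring.
Qed.

(** Polarization writes [dot z y] through norms alone, and the norm is continuous. *)
Lemma dot_cvgl (u : H ^nat) x y :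
  u @ \oo --> x -> (fun n => dot (u n) y) @ \oo --> dot x y.
Proof.
have dotE z : dot z y = 2^-1 * (`|z| ^+ 2 + `|y| ^+ 2 - `|z - y| ^+ 2).
  by rewrite sqr_normB !dot_norm; field.
move=> ux; rewrite dotE; under eq_fun do rewrite dotE.
apply: cvgMl_tmp; apply: cvgB; first apply: cvgD.
- by rewrite expr2; under eq_fun do rewrite expr2; apply: cvgM; apply: cvg_norm.
- exact: cvg_cst.
- rewrite expr2; under eq_fun do rewrite expr2.
  by apply: cvgM; apply: cvg_norm; apply: cvgB => //; exact: cvg_cst.
Qed.

Lemma parseval (e : H ^nat) u v : orthonormal_basis dot e ->
  series (fun k => dot (e k) u * dot (e k) v) @ \oo --> dot u v.
Proof.
move=> [_ /(_ u) eu].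
have -> : series (fun k => dot (e k) u * dot (e k) v) =
    fun n => dot (series (fun k => dot u (e k) *: e k) n) v; last exact: dot_cvgl.
apply/funext => n; rewrite /series/= dot_suml; apply: eq_bigr => k _.
by rewrite dotZl [dot u _]dotC.
Qed.

Lemma sqr_norm_orthonormal (e : H ^nat) (c : R ^nat) (r : seq nat) :
  (forall i j, dot (e i) (e j) = (i == j)%:R) -> uniq r ->
  `|\sum_(k <- r) c k *: e k| ^+ 2 = \sum_(k <- r) c k ^+ 2.
Proof.
move=> eE r_uniq; rewrite dot_norm dot_suml; apply: eq_big_seq => i ir.
rewrite dot_sumr (bigD1_seq i)//= big1 => [|j jNi].
  by rewrite dotZl dotZr eE eqxx mulr1 addr0 expr2.
by rewrite dotZl dotZr eE eq_sym (negbTE jNi) !mulr0.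
Qed.

(** With [y] the orthogonal projection of [x] onto the span of the [f j], both [dot x y] and
    [dot y y] equal the sum, so [|x - y|^2 >= 0] is the claim. Orthonormality is asked on [r] only,
    since discrete eigenvectors are controlled only up to index [N]. *)
Lemma bessel (r : seq nat) (f : nat -> H) x : uniq r ->
  {in r &, forall i j, dot (f i) (f j) = (i == j)%:R} ->
  \sum_(j <- r) dot x (f j) ^+ 2 <= dot x x.
Proof.
move=> r_uniq fE; set y := \sum_(j <- r) dot x (f j) *: f j.
have xy : dot x y = \sum_(j <- r) dot x (f j) ^+ 2.
  by rewrite dot_sumr; apply: eq_bigr => j _; rewrite dotZr.
have yy : dot y y = \sum_(j <- r) dot x (f j) ^+ 2.
  rewrite dot_suml; apply: eq_big_seq => i ir.
  rewrite dot_sumr (bigD1_seq i)//= big1_seq => [|j /andP[jNi jr]].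
    by rewrite dotZl dotZr fE// eqxx mulr1 addr0 expr2.
  by rewrite dotZl dotZr fE// eq_sym (negbTE jNi) !mulr0.
by have := sqr_ge0 `|x - y|; rewrite sqr_normB xy yy; lra.
Qed.

(** Riesz-Fischer: by Pythagoras a block of the vector series has squared norm the same block of the
    scalar series, so the Cauchy criterion carries over with tolerance [d ^+ 2], and [H] is
    complete. *)
Lemma cvg_orthonormal_series (e : H ^nat) (c : R ^nat) :
  (forall i j, dot (e i) (e j) = (i == j)%:R) ->
  cvgn (series (fun k => c k ^+ 2)) -> cvgn (series (fun k => c k *: e k)).
Proof.
move=> eE /cauchy_cvgP/cauchy_seriesP c_cauchy.
apply/cauchy_cvgP/cauchy_seriesP => d d_gt0.
apply: filterS (c_cauchy (d ^+ 2) _); last by rewrite exprn_gt0.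
move=> n c_lt; rewrite -(@ltr_pXn2r _ 2)// ?nnegrE ?(ltW d_gt0)//.
rewrite sqr_norm_orthonormal//; last exact: iota_uniq.
by apply: le_lt_trans c_lt; rewrite ler_norm.
Qed.

(** * Hilbert-Schmidt norms of differences of finite-rank maps *)

Lemma hs_normE (e : H ^nat) (B : H -> H) l :
  series (fun k => `|B (e k)| ^+ 2) @ \oo --> l ->
  (hs_norm e B ^+ 2 = l%:E)%E.
Proof.
move=> Bl; rewrite /hs_norm sqr_sqrte; last first.
  by apply: nneseries_ge0 => k _ _; rewrite lee_fin sqr_ge0.
have -> : (fun n => \sum_(0 <= k < n) (`|B (e k)| ^+ 2)%:E)%E =
    EFin \o series (fun k => `|B (e k)| ^+ 2).
  by apply/funext => n /=; rewrite sumEFin.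
by rewrite EFin_lim; [congr EFin; exact/cvg_lim|exact/cvgP/Bl].
Qed.

(* The Hilbert-Schmidt inner product of [\sum_i (., a i) b i] and
   [\sum_j (., a' j) b' j]. *)
Definition hs_dot I (r : seq I) (a b a' b' : I -> H) : R :=
  \sum_(i <- r) \sum_(j <- r) dot (a i) (a' j) * dot (b i) (b' j).

(** Exchanging the finite sums with the series leaves, for each pair [(i, j)], the Parseval series
    of [dot (a i) (a' j)]. *)
Lemma hs_dot_cvg (e : H ^nat) I (r : seq I) (a b a' b' : I -> H) :
  orthonormal_basis dot e ->
  series (fun k => dot (\sum_(i <- r) dot (e k) (a i) *: b i)
                       (\sum_(j <- r) dot (e k) (a' j) *: b' j)) @ \oo
    --> hs_dot r a b a' b'.
Proof.
move=> eb; have -> : series (fun k =>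
    dot (\sum_(i <- r) dot (e k) (a i) *: b i)
        (\sum_(j <- r) dot (e k) (a' j) *: b' j)) =
  fun n => \sum_(i <- r) \sum_(j <- r)
    series (fun k => dot (e k) (a i) * dot (e k) (a' j)) n * dot (b i) (b' j).
  apply/funext => n; rewrite /series/= ; under eq_bigr do rewrite dot_suml.
  rewrite exchange_big; apply: eq_bigr => i _.
  under eq_bigr do rewrite dot_sumr.
  rewrite exchange_big; apply: eq_bigr => j _.
  rewrite mulr_suml; apply: eq_bigr => k _.
  by rewrite dotZl dotZr mulrA.
apply: (cvg_big add_continuous) => i _; apply: (cvg_big add_continuous) => j _.
by apply: cvgMr_tmp; exact: parseval.
Qed.

(** This shape covers both the error of the density matrices and its image under [A^(1/2)]. *)
Lemma hs_norm_sub (e : H ^nat) I (r : seq I) (a b a' b' : I -> H) (B : H -> H) :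
  orthonormal_basis dot e ->
  (forall v, B v = \sum_(i <- r) dot v (a i) *: b i
                   - \sum_(i <- r) dot v (a' i) *: b' i) ->
  (hs_norm e B ^+ 2 = (hs_dot r a b a b - 2 * hs_dot r a b a' b'
                       + hs_dot r a' b' a' b')%:E)%E.
Proof.
move=> eb BE; apply: hs_normE.
have -> : series (fun k => `|B (e k)| ^+ 2) =
  (fun n =>
    series (fun k => dot (\sum_(i <- r) dot (e k) (a i) *: b i)
                       (\sum_(j <- r) dot (e k) (a j) *: b j)) n
   - 2 * series (fun k => dot (\sum_(i <- r) dot (e k) (a i) *: b i)
                       (\sum_(j <- r) dot (e k) (a' j) *: b' j)) n
   + series (fun k => dot (\sum_(i <- r) dot (e k) (a' i) *: b' i)
                       (\sum_(j <- r) dot (e k) (a' j) *: b' j)) n).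
  apply/funext => n; rewrite /series/=.
  rewrite mulr_sumr -sumrB -big_split/=.
  by apply: eq_bigr => k _; rewrite BE sqr_normB.
apply: cvgD; first apply: cvgB.
- exact: hs_dot_cvg.
- by apply: cvgMl_tmp; exact: hs_dot_cvg.
- exact: hs_dot_cvg.
Qed.

Lemma hs_dot_orthonormal (r : seq nat) (a b b' : nat -> H) : uniq r ->
  {in r &, forall i j, dot (a i) (a j) = (i == j)%:R} ->
  hs_dot r a b a b' = \sum_(i <- r) dot (b i) (b' i).
Proof.
move=> r_uniq aE; apply: eq_big_seq => i ir.
rewrite (bigD1_seq i)//= big1_seq => [|j /andP[jNi jr]].
  by rewrite aE// eqxx mul1r addr0.
by rewrite aE// eq_sym (negbTE jNi) mul0r.
Qed.



(** * Powers of the operator through their spectral partial sums *)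

Section Power.
Variables (lam : nat -> R) (phi : nat -> H) (s : R).
Hypothesis phi_basis : orthonormal_basis dot (fun k => phi k.+1).

(** The sums whose limit is [power]. They are linear in [v] at each [n], whereas the limit is
    meaningful only once convergence is known. *)
Definition power_partial (v : H) (n : nat) : H :=
  \sum_(1 <= k < n) (lam k `^ s * dot v (phi k)) *: phi k.

Lemma dot_phi i j : (0 < i)%N -> (0 < j)%N ->
  dot (phi i) (phi j) = (i == j)%:R.
Proof. by case: i j => [//|i] [//|j] _ _; rewrite phi_basis.1 eqSS. Qed.

Lemma power_partialB u v :
  power_partial (u - v) = power_partial u \- power_partial v.
Proof.
apply/funext => n; rewrite /power_partial/= -sumrB; apply: eq_bigr => k _.
by rewrite linearBl mulrBr scalerBl.
Qed.

Lemma power_partial_sum (I : Type) (r : seq I) (c : I -> R) (v : I -> H) :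
  power_partial (\sum_(i <- r) c i *: v i) =
  fun n => \sum_(i <- r) c i *: power_partial (v i) n.
Proof.
apply/funext => n; rewrite /power_partial.
under [RHS]eq_bigr do rewrite scaler_sumr.
rewrite exchange_big; apply: eq_bigr => k _.
rewrite dot_suml mulr_sumr scaler_suml; apply: eq_bigr => i _.
by rewrite dotZl scalerA mulrCA.
Qed.

(** Membership in the domain says that the coefficients [lam k ^ s * dot v (phi k)] are square
    summable, so Riesz-Fischer applies. *)
Lemma power_partial_cvg v : dom_power dot lam phi s v ->
  power_partial v @ \oo --> power dot lam phi s v.
Proof.
rewrite /dom_power/= => v_fin; suff : cvgn (power_partial v) by [].
apply/cvg_ex; have /cvg_ex[w vw] : cvgn (series (fun k =>
    (lam k.+1 `^ s * dot v (phi k.+1)) *: phi k.+1)).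
  apply: cvg_orthonormal_series phi_basis.1 _.
  apply: nondecreasing_is_cvgn.
    by apply: nondecreasing_series => n _ _; exact: sqr_ge0.
  exists (fine (\sum_(1 <= k <oo)
    (lam k `^ (2 * s) * `|dot v (phi k)| ^+ 2)%:E)%E) => _ [n _ <-].
  have ge0 k : (0 <= (lam k `^ (2 * s) * `|dot v (phi k)| ^+ 2)%:E)%E.
    by rewrite lee_fin mulr_ge0 ?powR_ge0.
  rewrite -lee_fin fineK; last first.
    by rewrite ge0_fin_numE//; apply: nneseries_ge0 => k _ _; exact: ge0.
  apply: le_trans (nneseries_lim_ge n.+1 (fun k _ _ => ge0 k)).
  rewrite sumEFin lee_fin big_add1 /series/= ler_sum// => k _.
  by rewrite exprMn real_normK ?num_real// (mulrC 2) powRrM powR_mulrn ?powR_ge0.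
(* Indices start at 1, so the partial sum at [n.+1] has exactly [n] terms. *)
exists w; rewrite -cvg_shiftS.
have -> // : (fun n => power_partial v n.+1) = series (fun k =>
    (lam k.+1 `^ s * dot v (phi k.+1)) *: phi k.+1).
by apply/funext => n; rewrite /power_partial big_add1.
Qed.

(** The partial sums are constant from [n = i + 1] on. *)
Lemma power_partial_eigen i : (0 < i)%N ->
  power_partial (phi i) @ \oo --> lam i `^ s *: phi i.
Proof.
move=> i_gt0; apply: cvg_near_cst; exists i.+1 => // n /= ltin.
rewrite /power_partial (bigD1_seq i) ?iota_uniq ?mem_index_iota ?i_gt0//=.
rewrite dot_phi// eqxx mulr1 big1_seq ?addr0// => k /andP[kNi].
rewrite mem_index_iota => /andP[k_gt0 _].
by rewrite dot_phi// eq_sym (negbTE kNi) mulr0 scale0r.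
Qed.

(** Pairing a partial sum with [phi i] extracts its [i]-th coefficient as soon as [n > i];
    continuity of [dot] passes to the limit. *)
Lemma dot_power i v : (0 < i)%N -> dom_power dot lam phi s v ->
  dot (power dot lam phi s v) (phi i) = lam i `^ s * dot v (phi i).
Proof.
move=> i_gt0 /power_partial_cvg /(@dot_cvgl _ _ (phi i)) vi.
rewrite -(cvg_lim _ vi)//; apply/cvg_lim => //; apply: cvg_near_cst; exists i.+1 => // n /= ltin.
rewrite /power_partial dot_suml.
rewrite (bigD1_seq i) ?iota_uniq ?mem_index_iota ?i_gt0//=.
rewrite dotZl dot_phi// eqxx mulr1 big1_seq ?addr0// => k /andP[kNi].
rewrite mem_index_iota => /andP[k_gt0 _].
by rewrite dotZl dot_phi// (negbTE kNi) mulr0.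
Qed.

End Power.

End InnerProduct.

(** * Two-sided bound on the sum of eigenvalue errors *)

Theorem theorem4p1 (R : realType) (H : completeNormedModType R)
  (dot : {dot H for idfun})
  (dot_norm : induces_norm dot)
  (H_separable : separable_space H)
  (* the operator A and its eigenpairs *)
  (DA : set H) (A : H -> H)
  (A_self_adjoint : self_adjoint dot DA A)
  (A_positive : positive_definite dot DA A)
  (A_compact_resolvent : compact_resolvent DA A)
  (lam : nat -> R) (phi : nat -> H)
  (lam_gt0 : forall k, (1 <= k)%N -> 0 < lam k)
  (lam_nondecreasing : forall j k, (1 <= j)%N -> (j <= k)%N -> lam j <= lam k)
  (lam_cvg : lam @ \oo --> +oo)
  (phi_basis : orthonormal_basis dot (fun k => phi k.+1))
  (phi_eigen : forall k, (1 <= k)%N -> DA (phi k) /\ A (phi k) = lam k *: phi k)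
  (* the discretization *)
  (m M : nat) (m_ge1 : (1 <= m)%N) (m_le_M : (m <= M)%N)
  (Vh : set H) (N : nat)
  (Vh_dim : has_dim Vh N) (M_le_N : (M <= N)%N)
  (Vh_dom : Vh `<=` dom_power dot lam phi 2^-1)
  (lamh : nat -> R) (phih : nat -> H)
  (eigen_h : galerkin_eigenpairs dot lam phi Vh N lamh phih)
  (* spectral gaps *)
  (gap_m : (1 < m)%N -> lam m.-1 < lam m)
  (gap_M : lam M < lam M.+1)
  (* an arbitrary orthonormal basis in which Hilbert-Schmidt norms are computed *)
  (e : nat -> H) (e_basis : orthonormal_basis dot e) :
  let gamma0 := density_matrix dot m M phi in
  let gammah := density_matrix dot m M phih in
  let err := fun v => gamma0 v - gammah v in
  let sqrtA := power dot lam phi 2^-1 in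
  ((hs_norm e (fun v => sqrtA (err v)) ^+ 2 - (lam M)%:E * hs_norm e err ^+ 2
     <= (\sum_(m <= i < M.+1) (lamh i - lam i))%:E)
   /\ ((\sum_(m <= i < M.+1) (lamh i - lam i))%:E
     <= hs_norm e (fun v => sqrtA (err v)) ^+ 2))%E.
Proof.
move=> gamma0 gammah err sqrtA.
have [phihV phihE phih_eigen _ _] := eigen_h.
pose r := index_iota m M.+1.
have r_uniq : uniq r by exact: iota_uniq.
have r_gt0 i : i \in r -> (0 < i)%N.
  by rewrite mem_index_iota => /andP[/(leq_trans m_ge1)].
have r_leN i : i \in r -> (1 <= i <= N)%N.
  move=> ir; rewrite r_gt0//=; move: ir; rewrite mem_index_iota ltnS.
  by move=> /andP[_ /leq_trans]; exact.
have r_leM i : i \in r -> lam i <= lam M.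
  move=> ir; apply: lam_nondecreasing; first exact: r_gt0.
  by move: ir; rewrite mem_index_iota ltnS => /andP[].
have phi_on : {in r &, forall i j, dot (phi i) (phi j) = (i == j)%:R}.
  by move=> i j ir jr; rewrite (dot_phi phi_basis)// r_gt0.
have phih_on : {in r &, forall i j, dot (phih i) (phih j) = (i == j)%:R}.
  by move=> i j ir jr; rewrite phihE// r_leN.
have phih_dom i : i \in r -> dom_power dot lam phi 2^-1 (phih i).
  by move=> /r_leN ir; exact/Vh_dom/phihV.
have lamK i : (0 < i)%N -> lam i `^ 2^-1 * lam i `^ 2^-1 = lam i.
  by move=> i0; rewrite powR12_sqrt -?expr2 ?sqr_sqrtr// ltW// lam_gt0.
have sqrtA_err v : sqrtA (err v) =
    \sum_(i <- r) dot v (phi i) *: (lam i `^ 2^-1 *: phi i)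
    - \sum_(i <- r) dot v (phih i) *: sqrtA (phih i).
  (* Linearity is used on partial sums; each [phi i] and [phih i] then has its own limit, the latter
     because [Vh] lies in the domain of [A^(1/2)]. *)
  apply/cvg_lim => //; rewrite -/(power_partial dot lam phi 2^-1 (err v)).
  rewrite power_partialB !power_partial_sum; apply: cvgB.
    rewrite big_seq; under eq_fun do rewrite big_seq.
    apply: (cvg_big add_continuous) => i ir; apply: cvgZl_tmp.
    exact/(power_partial_eigen phi_basis)/r_gt0.
  rewrite big_seq; under eq_fun do rewrite big_seq.
  apply: (cvg_big add_continuous) => i ir; apply: cvgZl_tmp.
  exact/(power_partial_cvg dot_norm phi_basis)/phih_dom.
pose c i := \sum_(j <- r) dot (phi i) (phih j) ^+ 2.
have c_le1 i : i \in r -> c i <= 1.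
  move=> ir; apply: le_trans (bessel dot_norm _ r_uniq phih_on) _.
  by rewrite phi_on// eqxx.
have err2 : (hs_norm e err ^+ 2 = (\sum_(i <- r) (2 - 2 * c i))%:E)%E.
  rewrite (@hs_norm_sub _ _ _ dot_norm e _ r phi phi phih phih)//.
  rewrite !hs_dot_orthonormal//; congr EFin.
  rewrite mulr_sumr -sumrB -big_split/=; apply: eq_big_seq => i ir.
  rewrite phi_on// phih_on// eqxx mulr1n /c.
  suff -> : \sum_(j <- r) dot (phi i) (phih j) * dot (phi i) (phih j) =
      \sum_(j <- r) dot (phi i) (phih j) ^+ 2 by ring.
  by apply: eq_bigr => j _; rewrite expr2.
have sqrtA_err2 : (hs_norm e (fun v => sqrtA (err v)) ^+ 2 =
    (\sum_(i <- r) (lam i + lamh i - 2 * (lam i * c i)))%:E)%E.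
  rewrite (@hs_norm_sub _ _ _ dot_norm e _ r phi
    (fun i => lam i `^ 2^-1 *: phi i) phih (fun i => sqrtA (phih i)))//.
  rewrite !hs_dot_orthonormal//; congr EFin.
  rewrite mulr_sumr -sumrB -big_split/=; apply: eq_big_seq => i ir.
  (* The Galerkin equation tested with [phih i] itself gives [|A^(1/2) phih i|^2 = lamh i]. *)
  rewrite dotZl dotZr phi_on// phih_eigen ?r_leN//; last exact/phihV/r_leN.
  rewrite phih_on// eqxx mulr1n !mulr1 lamK ?r_gt0//.
  suff -> : \sum_(j <- r) dot (phi i) (phih j) *
      dot (lam i `^ 2^-1 *: phi i) (sqrtA (phih j)) = lam i * c i by ring.
  rewrite mulr_sumr; apply: eq_big_seq => j jr.
  rewrite dotZl (dotC _ _ (sqrtA _)) (dot_power dot_norm phi_basis) ?r_gt0//.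
    by rewrite (mulrA (lam i `^ _)) lamK ?r_gt0// (dotC _ (phih j)); ring.
  exact: phih_dom.
rewrite err2 sqrtA_err2 -EFinM -EFinB !lee_fin mulr_sumr -sumrB.
split; rewrite big_seq [leRHS]big_seq; apply: ler_sum => i ir.
(* Termwise, right side minus left side is [2 * (lam M - lam i) * (1 - c i)]. *)
- have := c_le1 i ir; have := r_leM i ir; nra.
(* Here the difference is [2 * lam i * (1 - c i)]. *)
- have := c_le1 i ir; have := lam_gt0 i (r_gt0 i ir); nra.
Qed.
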